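(* Let $f:\mathbb{R}^d\to\mathbb{R}$ be a convex cost function with Lipschitz continuous gradient and minimizer $x^*$. Let $t\mapsto x_t\in\mathbb{R}^d$ be a trajectory defined for $t\ge0$ and let $\lambda_t>0$ be an increasing function. If $\|x_t-x^*\|$ converges at the rate $\frac{1}{\lambda_t}$, i.e. $\|x_t-x^*\|=\mathcal{O}\left(\frac1{\lambda_t}\right)$, then the gradient converges at least at that rate, i.e. $\|\nabla f(x_t)\|=\mathcal{O}\left(\frac1{\lambda_t}\right)$ as $t\to\infty$.
   Context: $\|\cdot\|$ is the Euclidean norm. Lipschitz continuity of the gradient means that there is $L>0$ with $\|\nabla f(y)-\nabla f(x)\|\le L\|y-x\|$ for all $x,y\in\mathbb{R}^d$. For a function $h$ and a positive function $\nu$, $h(t)=\mathcal{O}(1/\nu(t))$ means $\limsup_{t\to\infty}|\nu(t)h(t)|<\infty$. *)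

(* Defs.v *)
From mathcomp Require Import all_boot all_order all_algebra.
From mathcomp Require Import all_classical all_reals all_analysis.

Set Implicit Arguments.
Unset Strict Implicit.
Unset Printing Implicit Defensive.

Import Order.TTheory GRing.Theory Num.Theory.
Import numFieldNormedType.Exports.

Local Open Scope classical_set_scope.
Local Open Scope ring_scope.

(* The norm [`|v|] that the library puts on ['rV[R]_d] is the sup norm, so the
   Euclidean norm is defined here. Both norms induce the same notion of
   differentiability. *)
Definition enorm (R : realType) (d : nat) (v : 'rV[R]_d) : R :=
  Num.sqrt (\sum_(i < d) v 0 i ^+ 2).

(* ['D_v f x] is a total operator: [grad f x] is meaningful only where [f] is
   differentiable. *)
Definition grad (R : realType) (d : nat) (f : 'rV[R]_d -> R^o) (x : 'rV[R]_d) :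
    'rV[R]_d :=
  \row_(i < d) 'D_(delta_mx 0 i) f x.

Definition lipschitz_gradient (R : realType) (d : nat)
    (f : 'rV[R]_d -> R^o) : Prop :=
  (forall x, differentiable f x) /\
  exists2 L : R, 0 < L &
    forall x y, enorm (grad f y - grad f x) <= L * enorm (y - x).

Definition minimizer (R : realType) (d : nat) (f : 'rV[R]_d -> R^o)
    (xstar : 'rV[R]_d) : Prop :=
  forall y, f xstar <= f y.

(* h(t) = O(1 / nu(t)) as t -> +oo, i.e. limsup_{t -> +oo} |nu(t) h(t)| < +oo;
   the limsup is taken in the extended reals. *)
Definition bigO_inv (R : realType) (h nu : R -> R) : Prop :=
  (limf_esup (fun t : R => (`|nu t * h t|)%:E) (pinfty_nbhs R) < +oo)%E.

(* Main.v *)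
Require Import Defs.
From mathcomp Require Import all_boot all_order all_algebra.
From mathcomp Require Import all_classical all_reals all_analysis.
Import Order.TTheory GRing.Theory Num.Theory.
Import numFieldNormedType.Exports.
Local Open Scope classical_set_scope.
Local Open Scope ring_scope.

(** The gradient vanishes at a minimizer ([grad_minimizer]), by Fermat's rule applied to the
    restrictions of [f] to the lines through [xstar].  The Lipschitz bound
    between [x t] and [xstar] therefore reads
    [enorm (grad f (x t)) <= L * enorm (x t - xstar)] for every [t], and
    multiplying a function by a constant preserves its rate.  As [bigO_inv] is
    phrased with an extended-real limsup, it is first turned into the existence
    of an eventual real bound ([bigO_invP]), for which domination by a constant
    multiple is immediate ([bigO_inv_dominated]). *)

Lemma bigO_invP (R : realType) (h nu : R -> R) :
  bigO_inv h nu <->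
  exists C : R, \forall t \near +oo, `|nu t * h t| <= C.
Proof.
split=> [/ereal_inf_lt[_ [V Voo <-]] supV_fin|[C hC]].
  (* [fine] loses nothing here: the supremum is not [+oo], and it is [-oo] only
     if [V] is empty. *)
  exists (fine (ereal_sup [set (`|nu t * h t|)%:E | t in V])).
  apply: filterS Voo => t Vt.
  have : ((`|nu t * h t|)%:E <= ereal_sup [set (`|nu t * h t|)%:E | t in V])%E.
    by apply: ereal_sup_ubound; exists t.
  by case: (ereal_sup _) supV_fin => [s| |]//=; rewrite lee_fin.
apply: le_lt_trans (ltry C).
have : (ereal_sup [set (`|nu t * h t|)%:E | t in [set t | `|nu t * h t| <= C]%R]
        <= C%:E)%E.
  by apply: ge_ereal_sup => _ [t /= Ct <-]; rewrite lee_fin.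
apply: le_trans; apply: ereal_inf_lbound.
by exists [set t | `|nu t * h t| <= C].
Qed.

Lemma bigO_inv_dominated (R : realType) (g h nu : R -> R) (L : R) :
    0 <= L -> (\forall t \near +oo, `|g t| <= L * `|h t|) ->
  bigO_inv h nu -> bigO_inv g nu.
Proof.
move=> L0 gh /bigO_invP[C hC]; apply/bigO_invP; exists (L * C).
apply: filterS2 gh hC => t ght hCt.
rewrite normrM (le_trans (ler_wpM2l (normr_ge0 _) ght))// mulrCA.
by rewrite -normrM ler_wpM2l.
Qed.

(** Fermat's rule: [h |-> f (h *: v + c)] is a differentiable function of one
    real variable with a minimum at 0, and its derivative there is
    ['D_v f c]. *)
Lemma derive_at_minimizer (R : realType) (d : nat) (f : 'rV[R]_d -> R^o)
    (c v : 'rV[R]_d) :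
  (forall y, differentiable f y) -> minimizer f c -> 'D_v f c = 0.
Proof.
move=> df fmin; pose g (h : R) : R := f (h *: v + c).
have dg t : derivable g t 1.
  by apply/derivable1_diffP; apply: (@differentiable_comp _ _ _ _ _ f).
have gmin : is_derive (0 : R) (1 : R) g 0.
  apply: (@derive1_at_min _ g (-1) 1 0) => //.
  - by rewrite in_itv/= ltrN10 ltr01.
  - by move=> t _; rewrite /g scale0r add0r.
rewrite -(@derive_val _ _ _ _ _ _ _ gmin) /derive.
set p := fun h => h^-1 *: _; set q := fun h => h^-1 *: _.
suff -> : p = q by [].
by apply/funext => h; rewrite /p /q /g /= addr0 scale0r add0r [_%:A]mulr1.
Qed.

Lemma grad_minimizer (R : realType) (d : nat) (f : 'rV[R]_d -> R^o)
    (c : 'rV[R]_d) :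
  (forall y, differentiable f y) -> minimizer f c -> grad f c = 0.
Proof.
by move=> df fmin; apply/rowP => i; rewrite !mxE derive_at_minimizer.
Qed.

Theorem lemma8 (R : realType) (d : nat) (f : 'rV[R]_d -> R^o)
    (xstar : 'rV[R]_d) (x : R -> 'rV[R]_d) (lambda : R -> R)
    (f_convex : convex_function setT f)
    (f_smooth : lipschitz_gradient f)
    (xstar_min : minimizer f xstar)
    (lambda_gt0 : forall t : R, 0 <= t -> 0 < lambda t)
    (lambda_incr : forall s t : R, 0 <= s -> s <= t -> lambda s <= lambda t)
    (x_rate : bigO_inv (fun t => enorm (x t - xstar)) lambda) :
  bigO_inv (fun t => enorm (grad f (x t))) lambda.
Proof.
have [df [L L0 gradL]] := f_smooth.
apply: bigO_inv_dominated (ltW L0) _ x_rate.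
apply: nearW => t; have := gradL xstar (x t).
by rewrite (grad_minimizer _ _ _ _ df xstar_min) subr0 !ger0_norm// sqrtr_ge0.
Qed.
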